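(* Let $K\subset\mathbb R^m$ be a nonzero closed convex cone and let $C\subset\mathbb R^m$ be a closed convex set with nonempty interior. Then the following assertions are equivalent: (i) $C$ is a $K$-invariant set, i.e. it is invariant with respect to the operations $\sqcap$, $\sqcup$, $\sqcap_*$ and $\sqcup_*$; (ii) the projection $P_C$ is $K$-isotone and $K^*$-isotone; (iii) the set $C$ can be represented by $C=\bigcap_{i\in\mathbb N}H_-(u_i,a_i)$, where each hyperplane $H(u_i,a_i)$, $i\in\mathbb N$, is tangent to $C$ and is $K$-invariant; (iv) $C$ can be represented by $C=\bigcap_{i\in\mathbb N}H_-(u_i,a_i)$, where each hyperplane $H(u_i,a_i)$, $i\in\mathbb N$, is tangent to $C$ and is a $K$-isotone projection set and a $K^*$-isotone projection set.
   Context: $\mathbb R^m$ carries the standard inner product $\langle\cdot,\cdot\rangle$. A convex cone is a nonempty set $K$ with $K+K\subset K$ and $tK\subset K$ for all $t\ge 0$; its dual is $K^*=\{y\in\mathbb R^m:\langle x,y\rangle\ge 0\ \forall x\in K\}$. Write $x\le y\iff y-x\in K$ and $x\le_* y\iff y-x\in K^*$. For a nonempty closed convex set $D$, $P_Dx$ is the unique nearest point of $D$ to $x$. Lattice-like operations: $x\sqcap y=P_{x-K}y$, $x\sqcup y=P_{x+K}y$, $x\sqcap_* y=P_{x-K^*}y$, $x\sqcup_* y=P_{x+K^*}y$. A set $M\subset\mathbb R^m$ is invariant with respect to one of these operations if applying it to any $x,y\in M$ gives a point of $M$; $M$ is $K$-invariant if it is invariant with respect to all four. A nonempty closed convex set $D$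 is a $K$-isotone projection set (equivalently, $P_D$ is $K$-isotone) if $x\le y$ implies $P_Dx\le P_Dy$; it is a $K^*$-isotone projection set ($P_D$ is $K^*$-isotone) if $x\le_* y$ implies $P_Dx\le_* P_Dy$. For $u\ne 0$ and $a\in\mathbb R^m$: $H(u,a)=\{x:\langle u,x\rangle=\langle u,a\rangle\}$ and $H_-(u,a)=\{x:\langle u,x\rangle\le\langle u,a\rangle\}$. ''Tangent to $C$'' is meant in the usual sense: the tangent hyperplane to the boundary surface of $C$ at a boundary point where this surface is differentiable.
   Formalization: In (iii) and (iv) the intersection runs over an index set I contained in N that may be empty, instead of all of N, because C = R^m satisfies (i) and (ii) but has no tangent hyperplane; for C different from R^m the two forms agree. *)

(* Defs.v *)
(* R^m is represented by row vectors over an arbitrary R : realType. *)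
From HB Require Import structures.
From mathcomp Require Import all_boot all_order all_algebra.
From mathcomp Require Import all_classical all_reals all_analysis.
Set Implicit Arguments.
Unset Strict Implicit.
Unset Printing Implicit Defensive.
Import Order.TTheory GRing.Theory Num.Theory.
Import numFieldNormedType.Exports.
Local Open Scope classical_set_scope.
Local Open Scope ring_scope.

Section Defs.
Variables (R : realType) (m : nat).
Implicit Types (x y u a p e : 'rV[R]_m) (K D M H : set 'rV[R]_m).

Definition inner x y : R := \sum_(i < m) x 0 i * y 0 i.

(* The library norm `|x| on 'rV[R]_m is the sup norm; nearest points are taken
   with respect to the Euclidean norm. *)
Definition enorm x : R := Num.sqrt (inner x x).

Definition convex_cone K : Prop :=
  [/\ K !=set0,
      forall x y, K x -> K y -> K (x + y)
    & forall (t : R) x, 0 <= t -> K x -> K (t *: x)].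

Definition dual_cone K : set 'rV[R]_m :=
  [set y | forall x, K x -> 0 <= inner x y].

Definition cone_le K x y : Prop := K (y - x).

(* A point of D nearest to x. It exists and is unique for D nonempty, closed
   and convex; the default value x of xget is then never used. *)
Definition metric_proj D x : 'rV[R]_m :=
  xget x [set p | D p /\ forall q, D q -> enorm (x - p) <= enorm (x - q)].

Definition cap_op K x y := metric_proj [set x - k | k in K] y.
Definition cup_op K x y := metric_proj [set x + k | k in K] y.

Definition op_invariant (op : 'rV[R]_m -> 'rV[R]_m -> 'rV[R]_m) M : Prop :=
  forall x y, M x -> M y -> M (op x y).

Definition K_invariant K M : Prop :=
  [/\ op_invariant (cap_op K) M,
      op_invariant (cup_op K) M,
      op_invariant (cap_op (dual_cone K)) M
    & op_invariant (cup_op (dual_cone K)) M].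

Definition isotone K (f : 'rV[R]_m -> 'rV[R]_m) : Prop :=
  forall x y, cone_le K x y -> cone_le K (f x) (f y).

Definition isotone_projection_set K D : Prop :=
  [/\ D !=set0, closed D, convex_set D & isotone K (metric_proj D)].

Definition hyperplane u a : set 'rV[R]_m := [set x | inner u x = inner u a].
Definition halfspace u a : set 'rV[R]_m := [set x | inner u x <= inner u a].

Definition frontier D : set 'rV[R]_m := closure D `\` D°.

(* Near p, the set S is the graph, in the direction e, of a real function on
   the orthogonal complement of e. Such a function is encoded as an f on the
   whole space that is constant along e. *)
Definition locally_graph (S : set 'rV[R]_m) p e (f : 'rV[R]_m -> R) : Prop :=
  [/\ e != 0,
      forall x (t : R), f (x + t *: e) = f x
    & \forall x \near p, S x <-> inner e x = f x].

(* H is the tangent hyperplane of the surface frontier D at some point p where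
   this surface is differentiable, i.e. it is locally the graph of an f that is
   differentiable at p, and H is the graph of the affine approximation of f. *)
Definition tangent_to D H : Prop :=
  exists p e f,
    [/\ frontier D p, locally_graph (frontier D) p e f, differentiable f p
      & H = [set x | inner e (x - p) = 'd f p (x - p)]].

End Defs.

(* Main.v *)
(* If z = a - b with a in K, b in the dual cone and <a, b> = 0 (Moreau), the
   operations applied to x and y, z = y - x, give x + a = y + b and
   x - b = y - a. So invariance of C makes these points admissible tests in the
   variational inequalities of the projections, and isotonicity follows.
   A hyperplane with normal u is isotone iff z - (<u,z>/<u,u>) u maps K into K,
   which forces <u,a><u,b> <= 0; this makes the half-space invariant.
   The tangent hyperplanes are taken only at boundary points p nearest to an
   interior point c of C. There the boundary is squeezed between a ball and its
   tangent hyperplane, so it is differentiable without Rademacher's theorem, and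
   the blow-up of the projection at p transfers isotonicity to the hyperplane.
   Taking c in a countable dense set already gives enough half-spaces. *)
Require Import Defs.
From HB Require Import structures.
From mathcomp Require Import all_boot all_order all_algebra.
From mathcomp Require Import all_classical all_reals all_analysis.
From mathcomp Require Import ring lra.
Set Implicit Arguments.
Unset Strict Implicit.
Unset Printing Implicit Defensive.
Import Order.TTheory GRing.Theory Num.Theory.
Import numFieldNormedType.Exports.
Local Open Scope classical_set_scope.
Local Open Scope ring_scope.

(** A quadratic bound on the increments is little-o of [h], and uniqueness of the differential
    identifies it as 0. *)
Lemma quadratic_differentiable (R : realType) (V : normedModType R)
    (f : V -> R) (p : V) (M : R) :
  (\forall h \near 0, `|f (h + p) - f p| <= M * `|h| ^+ 2) ->
  differentiable f p /\ 'd f p = 0 :> (V -> R).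
Proof.
move=> fM.
have eqo : f \o shift p = cst (f p) + (\0 : V -> R) +o_ 0 id.
  apply/eqaddoP => e e0.
  have M0 : 0 < `|M| + 1 by rewrite ltr_wpDl.
  have eM : 0 < e / (`|M| + 1) by rewrite divr_gt0.
  near=> h.
  have -> : (f \o shift p - (cst (f p) + \0)) h = f (h + p) - f p.
    by rewrite -[LHS]/(f (h + p) - (f p + 0)) addr0.
  have hM : `|f (h + p) - f p| <= M * `|h| ^+ 2 by near: h.
  have he : `|h| <= e / (`|M| + 1).
    by near: h; exact: nbhs0_le.
  rewrite ler_pdivlMr // in he.
  apply: le_trans hM _; rewrite expr2 mulrA ler_wpM2r //.
  have := ler_norm M; have := normr_ge0 h; nra.
have d0 : 'd f p = 0 :> (V -> R).
  by apply: diff_unique eqo; exact: cst_continuous.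
split=> //; apply/diff_locallyP; rewrite d0; split=> //; exact: cst_continuous.
Unshelve. all: by end_near. Qed.

(** * Inner product, Euclidean balls and nearest points *)

Section Euclid.
Variables (R : realType) (m : nat).
Implicit Types (x y z u v : 'rV[R]_m) (t r : R) (A D : set 'rV[R]_m).

Lemma innerC x y : inner x y = inner y x.
Proof. by apply: eq_bigr => i _; rewrite mulrC. Qed.

Lemma innerDl x y z : inner (x + y) z = inner x z + inner y z.
Proof. by rewrite -big_split; apply: eq_bigr => i _; rewrite mxE mulrDl. Qed.

Lemma innerZl t x y : inner (t *: x) y = t * inner x y.
Proof. by rewrite mulr_sumr; apply: eq_bigr => i _; rewrite mxE mulrA. Qed.

Lemma innerNl x y : inner (- x) y = - inner x y.
Proof. by rewrite -scaleN1r innerZl mulN1r. Qed.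

Lemma innerDr x y z : inner x (y + z) = inner x y + inner x z.
Proof. by rewrite innerC innerDl !(innerC x). Qed.

Lemma innerZr t x y : inner x (t *: y) = t * inner x y.
Proof. by rewrite innerC innerZl innerC. Qed.

Lemma innerNr x y : inner x (- y) = - inner x y.
Proof. by rewrite innerC innerNl innerC. Qed.

Definition innerE :=
  (innerDl, innerDr, innerNl, innerNr, innerZl, innerZr).

Lemma inner0r x : inner x 0 = 0.
Proof. by rewrite -(scale0r x) innerZr mul0r. Qed.

Lemma inner_sub_sym x y : inner (x - y) (x - y) = inner (y - x) (y - x).
Proof. by rewrite -opprB innerNl innerNr opprK. Qed.

Lemma inner_ge0 x : 0 <= inner x x.
Proof. by apply: sumr_ge0 => i _; rewrite -expr2 sqr_ge0. Qed.

Lemma sqr_coord_le_inner x i : x 0 i ^+ 2 <= inner x x.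
Proof.
rewrite /inner (bigD1 i) //= -expr2 lerDl.
by apply: sumr_ge0 => j _; rewrite -expr2 sqr_ge0.
Qed.

Lemma inner_eq0 x : inner x x = 0 -> x = 0.
Proof.
move=> x0; apply/rowP => i; rewrite mxE; apply/eqP.
by rewrite -sqrf_eq0 eq_le sqr_ge0 andbT -x0 sqr_coord_le_inner.
Qed.

Lemma inner_gt0 x : x != 0 -> 0 < inner x x.
Proof.
move=> x0; rewrite lt_def inner_ge0 andbT.
by apply: contraNneq x0 => /inner_eq0->.
Qed.

Lemma cauchy_schwarz x y : inner x y ^+ 2 <= inner x x * inner y y.
Proof.
have [->|x0] := eqVneq x 0.
  by rewrite innerC inner0r expr0n mulr_ge0 ?inner_ge0.
have xx := inner_gt0 x0.
have := inner_ge0 (inner x x *: y - inner x y *: x).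
rewrite !innerE (innerC y x); nra.
Qed.

Lemma inner_le_mx_norm x : inner x x <= m%:R * `|x| ^+ 2.
Proof.
have -> : m%:R * `|x| ^+ 2 = \sum_(i < m) `|x| ^+ 2.
  by rewrite sumr_const card_ord mulr_natl.
apply: ler_sum => i _.
rewrite -expr2 -[X in X <= _]real_normK ?num_real // lerXn2r ?nnegrE //.
rewrite [in X in _ <= X]/Num.norm /= mx_normrE.
by apply/bigmax_geP; right; exists (0, i).
Qed.

Lemma mx_norm_le_inner x : `|x| ^+ 2 <= inner x x.
Proof.
rewrite -[X in _ <= X]sqr_sqrtr ?inner_ge0 //.
rewrite lerXn2r ?nnegrE ?sqrtr_ge0 // /Num.norm /= mx_normrE.
apply/bigmax_leP; split=> [|[i j] _ /=]; first exact: sqrtr_ge0.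
by rewrite -sqrtr_sqr ler_wsqrtr // ord1 sqr_coord_le_inner.
Qed.

(** Bridge between the sup-norm topology and Euclidean balls, by the two norm comparisons above. *)
Lemma nbhs_innerP x A :
  nbhs x A <->
  exists2 r, 0 < r & forall y, inner (y - x) (y - x) < r ^+ 2 -> A y.
Proof.
split=> [/nbhs_ballP[e /= e0 eA]|[r r0 rA]].
  exists e => // y yx; apply: eA.
  rewrite -ball_normE /ball_ /= distrC.
  have := le_lt_trans (mx_norm_le_inner (y - x)) yx.
  by rewrite ltr_pXn2r ?nnegrE // ltW.
have m1 : 0 < m%:R + 1 :> R by rewrite ltr_wpDl.
(* This radius suffices because m <= (m + 1)^2; the added 1 covers m = 0. *)
apply/nbhs_ballP; exists (r / (m%:R + 1)); first by rewrite /= divr_gt0.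
move=> y; rewrite -ball_normE /ball_ /= distrC => yx; apply: rA.
apply: le_lt_trans (inner_le_mx_norm _) _.
move: yx; rewrite ltr_pdivlMr // => yx.
have : (`|y - x| * (m%:R + 1)) ^+ 2 < r ^+ 2.
  by rewrite ltr_pXn2r ?nnegrE ?mulr_ge0 // ltW.
apply: le_lt_trans; rewrite exprMn mulrC ler_wpM2l ?sqr_ge0 //.
have : 0 <= m%:R :> R by []. nra.
Qed.

Lemma closed_innerP A x : closed A ->
  (forall r, 0 < r -> exists2 y, A y & inner (y - x) (y - x) < r ^+ 2) -> A x.
Proof.
move=> clA xA; rewrite (closure_id A).1 // => B /nbhs_innerP[r r0 rB].
by have [y Ay yx] := xA _ r0; exists y; split=> //; apply: rB.
Qed.

Lemma cvg_inner {T} (F : set_system T) {FF : Filter F}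
    (f g : T -> 'rV[R]_m) x y :
  f @ F --> x -> g @ F --> y -> (fun s => inner (f s) (g s)) @ F --> inner x y.
Proof.
move=> fx gy; apply: cvg_big => [|i _]; first exact: add_continuous.
apply: cvgM.
  exact: cvg_comp fx (@coord_continuous _ _ _ 0 i x).
exact: cvg_comp gy (@coord_continuous _ _ _ 0 i y).
Qed.

(** Cutting [D] by the ball around [x] through one of its points leaves a compact set, where the
    squared distance attains its minimum. *)
Lemma nearest_exists D x : D !=set0 -> closed D ->
  exists2 p, D p &
    forall q, D q -> inner (x - p) (x - p) <= inner (x - q) (x - q).
Proof.
move=> [q0 Dq0] clD.
have cf : continuous (fun q : 'rV[R]_m => inner (x - q) (x - q)).
  have cB (q : 'rV[R]_m) : (fun q' : 'rV[R]_m => x - q') @ q --> x - q.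
    exact: (@cvgB _ _ _ _ _ (cst x) id _ _ (cvg_cst x) (@cvg_id _ (nbhs q))).
  by move=> q; exact: cvg_inner (cB q) (cB q).
pose r := inner (x - q0) (x - q0).
pose B := D `&` [set q : 'rV[R]_m | inner (x - q) (x - q) <= r].
have clB : closed B.
  apply: closedI => //.
  have -> : [set q : 'rV[R]_m | inner (x - q) (x - q) <= r] =
            (fun q : 'rV[R]_m => inner (x - q) (x - q)) @^-1`
            [set s | s <= r] by [].
  by apply: preimage_closed; [move=> q _; exact: cf|exact: closed_le].
have bB : bounded_set B.
  exists (`|x| + Num.sqrt r); split; first exact: num_real.
  move=> M rM q [_ /= qr]; apply: le_trans (ltW rM).
  have -> : q = x - (x - q) by rewrite opprB addrC subrK.
  apply: le_trans (ler_normB _ _) _; rewrite lerD2l.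
  rewrite -[X in X <= _]ger0_norm // -sqrtr_sqr ler_wsqrtr //.
  exact: le_trans (mx_norm_le_inner _) qr.
have [||p /set_mem[Dp pr] pmin] := @EVT_min_rV R m
    (fun q : 'rV[R]_m => inner (x - q) (x - q)) B _
    (bounded_closed_compact bB clB).
- by exists q0; split => //=.
- exact: continuous_subspaceT.
exists p => // q Dq; have [qr|/ltW rq] := leP (inner (x - q) (x - q)) r.
  by apply: pmin; apply/mem_set.
exact: le_trans pr rq.
Qed.

(** Trades the bundled interval coefficients of [convex_set] for reals with explicit bounds. *)
Lemma convex_setP A : convex_set A <->
  forall x y t, 0 <= t -> t <= 1 -> A x -> A y -> A (t *: x + (1 - t) *: y).
Proof.
split=> [cA x y t t0 t1 Ax Ay|cA x y t /set_mem Ax /set_mem Ay].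
  have ti : Itv.spec (@Itv.num_sem R) (Itv.Real `[0%Z, 1%Z]) t.
    by rewrite /Itv.spec /= /Itv.num_sem /= num_real /= in_itv /= t0 t1.
  have /set_mem := cA x y (Itv.mk ti) (mem_set Ax) (mem_set Ay).
  by [].
by apply/mem_set; apply: cA.
Qed.

End Euclid.

(** * Metric projections and their variational inequality *)

Section Projection.
Variables (R : realType) (m : nat).
Implicit Types (x y z p q u a b : 'rV[R]_m) (t : R) (K D : set 'rV[R]_m).

Lemma enorm_le x y : (enorm x <= enorm y) = (inner x x <= inner y y).
Proof. by rewrite ler_psqrt ?nnegrE ?inner_ge0. Qed.

(** The variational inequality yields |x - p|^2 + |q - p|^2 <= |x - q|^2, which gives both
    minimality and uniqueness. *)
Lemma metric_projE D x p : D p ->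
  (forall q, D q -> inner (x - p) (q - p) <= 0) -> metric_proj D x = p.
Proof.
move=> Dp pvar.
have key q : D q ->
    inner (x - p) (x - p) + inner (q - p) (q - p) <= inner (x - q) (x - q).
  move=> /pvar; have -> : x - q = x - p - (q - p).
    by rewrite opprB addrA subrK.
  by move: (x - p) (q - p) => s w; rewrite !innerE (innerC w s); lra.
apply: xget_unique.
  split=> // q Dq; rewrite enorm_le; apply: le_trans (key q Dq).
  by rewrite lerDl inner_ge0.
move=> q [Dq /(_ p Dp)]; rewrite enorm_le => qp.
have := key q Dq; have := inner_ge0 (q - p) => h1 h2.
by apply/subr0_eq/inner_eq0; lra.
Qed.

Lemma metric_projP D x : D !=set0 -> closed D ->
  D (metric_proj D x) /\ forall q, D q ->
    inner (x - metric_proj D x) (x - metric_proj D x) <= inner (x - q) (x - q).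
Proof.
move=> D0 clD; have [p Dp pmin] := nearest_exists x D0 clD.
have [|Dq qmin] := @xgetPex _ x
    [set p | D p /\ forall q, D q -> enorm (x - p) <= enorm (x - q)].
  by exists p; split=> // q /pmin; rewrite enorm_le.
by split=> // q /qmin; rewrite enorm_le.
Qed.

Lemma metric_proj_le0 D x q : closed D -> convex_set D -> D q ->
  inner (x - metric_proj D x) (q - metric_proj D x) <= 0.
Proof.
move=> clD /convex_setP cD Dq.
have [|Dp pmin] := @metric_projP D x _ clD; first by exists q.
set p := metric_proj D x in Dp pmin *.
rewrite leNgt; apply/negP => pos.
set c := inner _ _ in pos; set d := inner (q - p) (q - p).
have d0 : 0 <= d by exact: inner_ge0.
(* Moving from [p] towards [q] by [t] changes the squared distance by -2tc + t^2 d; this [t] is at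
   most 1 and has td <= c, so the change is negative. *)
pose t := c / (c + d).
have cd : 0 < c + d by lra.
have t0 : 0 < t by rewrite divr_gt0.
have t1 : t <= 1 by rewrite ler_pdivrMr ?mul1r //; lra.
have := pmin _ (cD _ _ t (ltW t0) t1 Dq Dp).
have -> : x - (t *: q + (1 - t) *: p) = (x - p) - t *: (q - p).
  by apply/rowP => i; rewrite !mxE; ring.
have -> : inner (x - p - t *: (q - p)) (x - p - t *: (q - p)) =
    inner (x - p) (x - p) - 2 * t * c + t ^+ 2 * d.
  rewrite /c /d; move: (x - p) (q - p) => s w.
  by rewrite !innerE (innerC w s); ring.
move=> le.
have tcd : t * (c + d) = c by rewrite divfK // gt_eqF.
nra.
Qed.

Lemma metric_proj_id D x : D x -> metric_proj D x = x.
Proof.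
by move=> Dx; apply: metric_projE => // q _; rewrite subrr innerC inner0r.
Qed.

(** * Cones, duality, the Moreau decomposition and the lattice-like operations *)

Lemma convex_cone0 K : convex_cone K -> K 0.
Proof. by case=> [[x Kx] _ KZ]; rewrite -(scale0r x); apply: KZ. Qed.

Lemma convex_cone_convex K : convex_cone K -> convex_set K.
Proof.
case=> _ KD KZ; apply/convex_setP => x y t t0 t1 Kx Ky.
by apply: KD; apply: KZ; rewrite ?subr_ge0.
Qed.

Lemma dual_cone_convex_cone K : convex_cone (dual_cone K).
Proof.
split=> [|x y Kx Ky z Kz|t x t0 Kx z Kz].
- by exists 0 => x _; rewrite inner0r.
- by rewrite innerDr addr_ge0 ?Kx ?Ky.
- by rewrite innerZr mulr_ge0 ?Kx.
Qed.

Lemma dual_cone_closed K : closed (dual_cone K).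
Proof.
have -> : dual_cone K = \bigcap_(x in K) [set y | 0 <= inner x y] by [].
apply: closed_bigI => x _.
have -> : [set y | 0 <= inner x y] = (inner x) @^-1` [set s | 0 <= s] by [].
apply: preimage_closed; last exact: closed_ge.
move=> y _; exact: cvg_inner (cvg_cst x) (@cvg_id _ (nbhs y)).
Qed.

(** Take for [a] the projection of [z] on [K]. Testing it against 0 and [a + a] gives orthogonality,
    against [a + k] membership of [a - z] in the dual. *)
Lemma moreau K z : convex_cone K -> closed K ->
  exists a b, [/\ K a, dual_cone K b, inner a b = 0 & z = a - b].
Proof.
move=> Kc clK; have [K0 KD KZ] := Kc.
have [Ka _] := metric_projP z K0 clK.
have var q := @metric_proj_le0 K z q clK (convex_cone_convex Kc).
set a := metric_proj K z in Ka var.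
have aa : inner a (a - z) = 0.
  have := var _ (convex_cone0 Kc); have := var _ (KD _ _ Ka Ka).
  rewrite sub0r addrK !innerE (innerC z a) => ? ?.
  by apply/eqP; rewrite eq_le; apply/andP; split; lra.
exists a, (a - z); split=> //; last by rewrite opprB addrC subrK.
move=> k Kk; have := var _ (KD _ _ Ka Kk).
by rewrite addrAC subrr add0r !innerE (innerC z k) (innerC a k); lra.
Qed.

(** If [z = a - b] is in the bidual, pairing it with [b] gives -|b|^2 >= 0, so [b] vanishes. *)
Lemma dual_coneK K : convex_cone K -> closed K -> dual_cone (dual_cone K) = K.
Proof.
move=> Kc clK; apply/seteqP; split=> z Kz; last first.
  by move=> y Ky; rewrite innerC; apply: Ky.
have [a [b [Ka Kb ab zE]]] := moreau z Kc clK.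
suff b0 : b = 0 by rewrite zE b0 subr0.
apply: inner_eq0; apply/eqP; rewrite eq_le inner_ge0 andbT.
by have := Kz _ Kb; rewrite zE !innerE innerC ab; lra.
Qed.

(** Seen from [x - a], the residual of [y] is [b], which is orthogonal to [a] and pairs
    nonnegatively with [K]: this is the variational inequality. *)
Lemma cap_opE K x y a b : K a -> dual_cone K b -> inner a b = 0 ->
  x - y = a - b -> cap_op K x y = x - a.
Proof.
move=> Ka Kb ab xy; apply: metric_projE; first by exists a.
move=> _ [k Kk <-].
have -> : y - (x - a) = b.
  by rewrite opprB addrCA -opprB xy opprB addrCA subrr addr0.
rewrite opprB addrC addrA subrK innerDr innerNr innerC ab innerC.
by have := Kb _ Kk; lra.
Qed.

Lemma cup_opE K x y a b : K a -> dual_cone K b -> inner a b = 0 ->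
  y - x = a - b -> cup_op K x y = x + a.
Proof.
move=> Ka Kb ab xy; apply: metric_projE; first by exists a.
move=> _ [k Kk <-].
have -> : y - (x + a) = - b by rewrite opprD addrA xy addrAC subrr add0r.
rewrite opprD addrACA subrr add0r innerNl innerDr innerNr.
rewrite (innerC b a) ab innerC.
by have := Kb _ Kk; lra.
Qed.

(* With P x - P y = b - a the Moreau decomposition, the two operations move
   P x to P x - b and P y to P y + b without leaving D; testing the
   characterization of the projections against these points gives b = 0. *)
Lemma invariant_isotone K D : convex_cone K -> closed K ->
  D !=set0 -> closed D -> convex_set D ->
  op_invariant (cup_op K) D -> op_invariant (cap_op (dual_cone K)) D ->
  isotone K (metric_proj D).
Proof.
move=> Kc clK D0 clD cD cupD capD x y Kxy.
have [Dp _] := metric_projP x D0 clD; have [Dq _] := metric_projP y D0 clD.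
have varp c := @metric_proj_le0 D x c clD cD.
have varq c := @metric_proj_le0 D y c clD cD.
set p := metric_proj D x in Dp varp *; set q := metric_proj D y in Dq varq *.
rewrite /cone_le; have [a [b [Ka Kb ab qp]]] := moreau (q - p) Kc clK.
have Dpb : D (p - b).
  rewrite -(@cap_opE (dual_cone K) p q b a) ?(innerC b) //; first exact: capD.
    by move=> k Kk; rewrite innerC; apply: Kk.
  by rewrite -opprB qp opprB.
have Dqb : D (q + b).
  have -> : q + b = p + a by rewrite -[q](subrK p) qp addrAC subrK addrC.
  by rewrite -(cup_opE Ka Kb ab qp); apply: cupD.
suff b0 : b = 0 by rewrite qp b0 subr0.
apply: inner_eq0; apply/eqP; rewrite eq_le inner_ge0 andbT.
have := Kb _ Kxy; have := varp _ Dpb; have := varq _ Dqb.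
have -> : p - b - p = - b by rewrite addrAC subrr add0r.
have -> : q + b - q = b by rewrite addrAC subrr add0r.
have : inner (q - p) b = - inner b b by rewrite qp innerDl ab innerNl add0r.
by rewrite !innerE; lra.
Qed.

Lemma K_invariant_isotone K D : convex_cone K -> closed K ->
  D !=set0 -> closed D -> convex_set D -> K_invariant K D ->
  isotone K (metric_proj D) /\ isotone (dual_cone K) (metric_proj D).
Proof.
move=> Kc clK D0 clD cD [capD cupD capD' cupD']; split.
  exact: invariant_isotone.
(* For the dual cone the meet required is that of the bidual, which is [K] again. *)
apply: invariant_isotone => //; [exact: dual_cone_convex_cone|
  exact: dual_cone_closed|by rewrite dual_coneK].
Qed.

(** * Hyperplanes and half-spaces: isotonicity and invariance *)

Lemma hyperplane_closed u a : closed (hyperplane u a).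
Proof.
have -> : hyperplane u a = inner u @^-1` [set inner u a] by [].
apply: preimage_closed; last exact: closed_eq.
by move=> y _; exact: cvg_inner (cvg_cst u) (@cvg_id _ (nbhs y)).
Qed.

Lemma hyperplane_convex u a : convex_set (hyperplane u a).
Proof.
apply/convex_setP => x y t _ _; rewrite /hyperplane /= !innerE => -> ->; ring.
Qed.

Lemma hyperplane_neq0 u a : hyperplane u a !=set0.
Proof. by exists a. Qed.

(** Orthogonal projection onto the linear hyperplane with normal [u], the linear part of the
    projection onto every [hyperplane u a]. *)
Definition orth u z := z - (inner u z / inner u u) *: u.

Lemma inner_orth u z : u != 0 -> inner u (orth u z) = 0.
Proof.
move=> /inner_gt0 uu; rewrite /orth !innerE divfK ?subrr // gt_eqF //.
Qed.

Lemma metric_proj_hyperplane u a x : u != 0 ->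
  metric_proj (hyperplane u a) x = a + orth u (x - a).
Proof.
move=> u0; apply: metric_projE.
  by rewrite /hyperplane /= innerDr inner_orth // addr0.
move=> q qu; have -> : x - (a + orth u (x - a)) =
    (inner u (x - a) / inner u u) *: u.
  rewrite /orth addrA [a + (x - a)]addrCA subrr addr0.
  by rewrite opprB addrCA subrr addr0.
rewrite innerZl.
suff -> : inner u (q - (a + orth u (x - a))) = 0 by rewrite mulr0.
move: (orth u _) (inner_orth (x - a) u0) => w uw.
by rewrite !(innerDr, innerNr) uw qu addr0 subrr.
Qed.

(** Isotonicity is tested on [a] and [a + z]: the first is fixed, the second goes to
    [a + orth u z]. *)
Lemma isotone_hyperplane_orth K u a z : convex_cone K -> u != 0 ->
  isotone K (metric_proj (hyperplane u a)) -> K z -> K (orth u z).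
Proof.
move=> Kc u0 iso Kz; have := iso a (a + z); rewrite /cone_le.
rewrite !metric_proj_hyperplane // addrAC subrr add0r.
rewrite /orth inner0r mul0r scale0r subr0 addr0 addrAC subrr add0r.
exact.
Qed.

(** Since [orth u a] is in [K], its pairing with [b], equal to -<u,a><u,b>/<u,u>, is nonnegative. *)
Lemma orth_sign K u a b : u != 0 -> (forall z, K z -> K (orth u z)) ->
  K a -> dual_cone K b -> inner a b = 0 -> inner u a * inner u b <= 0.
Proof.
move=> u0 Ku Ka Kb ab; have := Kb _ (Ku _ Ka); have := inner_gt0 u0.
rewrite /orth !innerE ab add0r oppr_ge0 => uu.
by rewrite mulrAC pmulr_lle0 // invr_gt0.
Qed.

(** The meet is x - a = y - b and the join x + a = y + b. As <u,a> and <u,b> never have the same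
    strict sign, one of the two expressions does not increase the value of <u,.>. *)
Lemma halfspace_invariant K u c : convex_cone K -> closed K -> u != 0 ->
  (forall z, K z -> K (orth u z)) ->
  op_invariant (cap_op K) (halfspace u c) /\
  op_invariant (cup_op K) (halfspace u c).
Proof.
move=> Kc clK u0 Ku; split=> x y; rewrite /halfspace /= => xc yc.
  have [a [b [Ka Kb ab xy]]] := moreau (x - y) Kc clK.
  rewrite (cap_opE Ka Kb ab xy); have := orth_sign u0 Ku Ka Kb ab.
  have : inner u (x - y) = inner u (a - b) by rewrite xy.
  rewrite !innerE; nra.
have [a [b [Ka Kb ab xy]]] := moreau (y - x) Kc clK.
rewrite (cup_opE Ka Kb ab xy); have := orth_sign u0 Ku Ka Kb ab.
have : inner u (y - x) = inner u (a - b) by rewrite xy.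
rewrite !innerE; nra.
Qed.

(** On a hyperplane <u,a> = <u,b>, and a nonpositive product of equal numbers makes both 0, so the
    operations move points along it. *)
Lemma hyperplane_invariant K u c : convex_cone K -> closed K -> u != 0 ->
  (forall z, K z -> K (orth u z)) ->
  op_invariant (cap_op K) (hyperplane u c) /\
  op_invariant (cup_op K) (hyperplane u c).
Proof.
move=> Kc clK u0 Ku.
have key a b : K a -> dual_cone K b -> inner a b = 0 ->
    inner u (a - b) = 0 -> inner u a = 0.
  move=> Ka Kb ab; have := orth_sign u0 Ku Ka Kb ab.
  rewrite !innerE => sgn eq; apply/eqP; rewrite -sqrf_eq0 eq_le sqr_ge0 andbT.
  by nra.
split=> x y; rewrite /hyperplane /= => xc yc.
  have [a [b [Ka Kb ab xy]]] := moreau (x - y) Kc clK.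
  rewrite (cap_opE Ka Kb ab xy) innerDr innerNr (key a b) // ?subr0 //.
  by rewrite -xy innerDr innerNr xc yc subrr.
have [a [b [Ka Kb ab xy]]] := moreau (y - x) Kc clK.
rewrite (cup_opE Ka Kb ab xy) innerDr (key a b) // ?addr0 //.
by rewrite -xy innerDr innerNr xc yc subrr.
Qed.

End Projection.

(** * Boundary points touched by a ball inside the convex set *)

Section Touching.
Variables (R : realType) (m : nat).
Implicit Types (x y z w p q u c : 'rV[R]_m) (t s r : R) (K C : set 'rV[R]_m).

Lemma nbhs_open_ball c p r : inner (p - c) (p - c) < r ->
  nbhs p [set y | inner (y - c) (y - c) < r].
Proof.
move=> pr.
have cB : (fun y : 'rV[R]_m => y - c) @ p --> p - c.
  exact: (@cvgB _ _ _ _ _ id (cst c) _ _ (@cvg_id _ (nbhs p)) (cvg_cst c)).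
exact: (cvgr_lt _ (cvg_inner cB cB) _ pr).
Qed.

Lemma convex_interior C x p t : convex_set C -> C° p -> C x ->
  0 <= t -> t < 1 -> C° (t *: x + (1 - t) *: p).
Proof.
move=> /convex_setP cC /nbhs_innerP[r r0 rC] Cx t0 t1.
have t1' : 0 < 1 - t by rewrite subr_gt0.
apply/nbhs_innerP; exists ((1 - t) * r); first by rewrite mulr_gt0.
(* [y'] is the preimage of [y] under the homothety with centre [x] and ratio [1 - t], hence within
   [r] of [p]. *)
move=> y yr; pose y' := p + (1 - t)^-1 *: (y - (t *: x + (1 - t) *: p)).
have -> : y = t *: x + (1 - t) *: y'.
  rewrite /y' scalerDr scalerA mulfV ?gt_eqF // scale1r.
  by rewrite [in RHS]addrA addrC subrK.
apply: cC => //; first exact: ltW.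
apply: rC; rewrite /y' addrAC subrr add0r innerZl innerZr mulrA -expr2.
by rewrite exprVn mulrC ltr_pdivrMr ?exprn_gt0 // -exprMn mulrC.
Qed.

Lemma closed_ball_sub C c r : 0 < r -> closed C ->
  (forall y, inner (y - c) (y - c) < r -> C y) ->
  forall y, inner (y - c) (y - c) <= r -> C y.
Proof.
move=> r0 clC bC y yr; apply: closed_innerP clC _ => s s0.
(* [r] is a squared radius. Pulling [y] towards [c] by the ratio [t] moves it by at most t^2 r in
   squared distance, below s^2 because r < (1 + s + r)^2. *)
pose t := s / (1 + s + r).
have d0 : 0 < 1 + s + r by lra.
have t0 : 0 < t by rewrite divr_gt0.
have t1 : t < 1 by rewrite ltr_pdivrMr //; lra.
have ts : t * (1 + s + r) = s by rewrite divfK // gt_eqF.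
clearbody t.
exists (y - t *: (y - c)).
  apply: bC; have -> : y - t *: (y - c) - c = (1 - t) *: (y - c).
    by apply/rowP => i; rewrite !mxE; ring.
  rewrite innerZl innerZr; have := inner_ge0 (y - c).
  move: (inner _ _) yr => n nr n0; have n1 : (1 - t) * n <= r by nra.
  have : 0 <= (1 - t) * n by nra.
  have : t * r > 0 by rewrite mulr_gt0.
  by nra.
have -> : y - t *: (y - c) - y = - (t *: (y - c)).
  by rewrite addrAC subrr add0r.
rewrite innerNl innerNr opprK innerZl innerZr mulrA -expr2.
have : t ^+ 2 * inner (y - c) (y - c) <= t ^+ 2 * r.
  by rewrite ler_wpM2l ?sqr_ge0.
move=> /le_lt_trans; apply; rewrite -[in X in _ < X]ts exprMn.
rewrite ltr_pM2l ?exprn_gt0 //.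
have -> : (1 + s + r) ^+ 2 = 1 + 2 * (s + r) + (s + r) ^+ 2 by ring.
by have := sqr_ge0 (s + r); lra.
Qed.

Lemma frontierE C x : closed C -> frontier C x <-> C x /\ ~ C° x.
Proof. by move=> /closure_id clC; rewrite /frontier -clC. Qed.

(** The closed ball around [c] through [p] lies in [C] and meets its boundary at [p]; [p != c] makes
    the radius positive. *)
Definition touching C c p := [/\ p != c, C p, ~ C° p &
  forall y, inner (y - c) (y - c) <= inner (p - c) (p - c) -> C y].

(** [p] minimizes the distance to [c] outside the interior, so the open ball stays in [C] and
    closedness adds its sphere. *)
Lemma nearest_touching C c : closed C -> C° c -> C <> setT ->
  exists2 p, touching C c p &
    forall w, ~ C° w -> inner (c - p) (c - p) <= inner (c - w) (c - w).
Proof.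
move=> clC Cc CT.
have D0 : ~` C° !=set0.
  apply: contrapT => /set0P/negP/negPn/eqP CE; apply: CT.
  by apply/seteqP; split=> // x _; apply: interior_subset;
    apply: contrapT => Cx; have : (~` C°) x by []; rewrite CE.
have [p Cp pmin] := nearest_exists c D0 (open_closedC (@open_interior _ C)).
have pc : p != c by apply/eqP => pc; apply: Cp; rewrite pc.
have pc0 : 0 < inner (p - c) (p - c) by rewrite inner_gt0 // subr_eq0.
have bC : forall y, inner (y - c) (y - c) <= inner (p - c) (p - c) -> C y.
  apply: closed_ball_sub => // y yp; apply: interior_subset.
  by apply: contrapT => /pmin; rewrite !(inner_sub_sym c) leNgt yp.
by exists p => //; split=> //; apply: bC.
Qed.

(** * Supporting and tangent hyperplane at a touching point *)

Section TouchingPoint.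
Variables (C : set 'rV[R]_m) (c p : 'rV[R]_m).
Hypotheses (clC : closed C) (cC : convex_set C) (Ccp : touching C c p).
Let u := p - c.

Let u0 : u != 0.
Proof. by have [pc _ _ _] := Ccp; rewrite subr_eq0. Qed.

Let uu : 0 < inner u u. Proof. exact: inner_gt0. Qed.

Lemma open_ball_interior y : inner (y - c) (y - c) < inner u u -> C° y.
Proof.
have [_ _ _ bC] := Ccp.
move=> yu; apply: filterS (nbhs_open_ball yu) => z /= zu.
by apply: bC; apply: ltW.
Qed.

(** Were [x] strictly beyond the hyperplane, continuing the segment from [x] slightly past [p] would
    enter the open ball, making [p] interior. *)
Lemma touching_support x : C x -> inner u (x - p) <= 0.
Proof.
move=> Cx; have [_ Cp nCp bC] := Ccp; rewrite leNgt; apply/negP => pos.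
set s := inner _ _ in pos; pose d := inner (x - p) (x - p).
have d0 : 0 < d.
  by apply: inner_gt0; apply: contraTneq pos => xp; rewrite /s xp inner0r ltxx.
(* With this [t] the squared distance |u - t(x - p)|^2 equals <u,u> - ts. *)
pose t := s / d; have t0 : 0 < t by rewrite divr_gt0.
have td : t * d = s by rewrite divfK // gt_eqF.
apply: nCp; pose v := t / (1 + t).
have t1 : 0 < 1 + t by lra.
have vE : v * (1 + t) = t by rewrite divfK // gt_eqF.
have -> : p = v *: x + (1 - v) *: (p - t *: (x - p)).
  apply/rowP => i; rewrite !mxE.
  have -> : v * x 0 i + (1 - v) * (p 0 i - t * (x 0 i - p 0 i)) =
    p 0 i + (x 0 i - p 0 i) * (v * (1 + t) - t) by ring.
  by rewrite vE subrr mulr0 addr0.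
apply: convex_interior => //.
- apply: open_ball_interior; rewrite addrAC -/u.
  have -> : inner (u - t *: (x - p)) (u - t *: (x - p)) =
      inner u u - 2 * t * s + t * (t * d).
    rewrite /s /d; move: u (x - p) => a b.
    by rewrite !innerE (innerC b a); ring.
  by rewrite td; nra.
- by rewrite divr_ge0 // ltW.
- by rewrite ltr_pdivrMr // mul1r; lra.
Qed.

Lemma orth_decomp x : x = orth u x + (inner u x / inner u u) *: u.
Proof. by rewrite subrK. Qed.

Lemma inner_line w s : inner u w = 0 ->
  inner (w + s *: u - p) (w + s *: u - p) =
  inner (w - orth u p) (w - orth u p) +
  (s - inner u p / inner u u) ^+ 2 * inner u u.
Proof.
move=> uw; rewrite [in LHS](orth_decomp p); set s0 := _ / _.
have := inner_orth p u0; move: (orth u p) => w0 uw0.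
have -> : w + s *: u - (w0 + s0 *: u) = (w - w0) + (s - s0) *: u.
  by apply/rowP => i; rewrite !mxE; ring.
have uww : inner u (w - w0) = 0 by rewrite innerDr innerNr uw uw0 subrr.
move: (w - w0) (s - s0) u uww => v r e ev.
by rewrite !innerE (innerC v e) ev; ring.
Qed.

Lemma inner_line_center w s : inner u w = 0 ->
  inner (w + s *: u - c) (w + s *: u - c) =
  inner (w - orth u p) (w - orth u p) +
  (1 + s - inner u p / inner u u) ^+ 2 * inner u u.
Proof.
move=> uw; have -> : w + s *: u - c = w + (1 + s) *: u - p.
  by apply/rowP => i; rewrite !mxE; ring.
exact: inner_line.
Qed.

Definition line_top w s :=
  C (w + s *: u) /\ forall s', C (w + s' *: u) -> s' <= s.

Lemma line_top_unique w s s' : line_top w s -> line_top w s' -> s = s'.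
Proof.
by move=> [Cs sM] [Cs' sM']; apply/le_anti; rewrite sM' ?sM.
Qed.

Lemma line_top_exists w : inner u w = 0 ->
  inner (w - orth u p) (w - orth u p) < inner u u ->
  exists2 s, line_top w s &
    inner u p - inner (w - orth u p) (w - orth u p) <= s * inner u u
      <= inner u p.
Proof.
move=> uw wu; set d := inner _ _ in wu *.
have d0 : 0 <= d by exact: inner_ge0.
have [_ _ _ bC] := Ccp.
pose S := [set s | C (w + s *: u)].
(* [s0] is the height of [p] along [u], an upper bound by the supporting hyperplane. Height [s1] is
   still in the ball since (1 - d/<u,u>)^2 <= 1 - d/<u,u>. *)
pose s0 := inner u p / inner u u; pose s1 := s0 - d / inner u u.
have s0E : s0 * inner u u = inner u p by rewrite divfK // gt_eqF.
have d1 : d / inner u u < 1 by rewrite ltr_pdivrMr // mul1r.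
have dE : d / inner u u * inner u u = d by rewrite divfK // gt_eqF.
have Ss1 : S s1.
  apply: bC; rewrite inner_line_center // -/u -/s0 -/d.
  have -> : 1 + s1 - s0 = 1 - d / inner u u by rewrite /s1; ring.
  have := divr_ge0 d0 (ltW uu); move: (d / inner u u) d1 dE => a a1 aE a0.
  rewrite -aE; nra.
have Sub s : S s -> s <= s0.
  have -> : S s = C (w + s *: u) by [].
  move=> /touching_support.
  have -> : inner u (w + s *: u - p) = (s - s0) * inner u u.
    rewrite mulrBl s0E; move: u uw => e ew; rewrite !innerE ew; ring.
  by rewrite pmulr_lle0 // subr_le0.
have clS : closed S.
  have -> : S = (fun s => w + s *: u) @^-1` C by [].
  apply: preimage_closed => // s _.
  apply: (@cvgD _ _ _ _ _ (cst w) (fun s => s *: u)); first exact: cvg_cst.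
  exact: scalel_continuous.
have hub : has_ubound S by exists s0.
exists (sup S).
  split; last by move=> s Ss; apply: ub_le_sup.
  suff : S (sup S) by [].
  by rewrite [S in S _](closure_id S).1 //; apply: closure_sup => //; exists s1.
apply/andP; split; last first.
  by rewrite -s0E ler_wpM2r ?(ltW uu) //; apply: ge_sup; [exists s1|exact: Sub].
have : s1 <= sup S by apply: ub_le_sup.
by rewrite -(ler_pM2r uu); apply: le_trans; rewrite mulrBl s0E dE.
Qed.

Lemma inner_orth_le x : inner (orth u x) (orth u x) <= inner x x.
Proof.
have := inner_orth x u0; rewrite [in X in _ <= X](orth_decomp x).
move: (inner u x / _) (orth u x) => s w; move: u uu => e ee ew.
rewrite !innerE (innerC w e) ew; have := mulr_ge0 (sqr_ge0 s) (ltW ee).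
by rewrite expr2; lra.
Qed.

Lemma orthB x y : orth u x - orth u y = orth u (x - y).
Proof.
rewrite /orth innerDr innerNr.
by apply/rowP => i; rewrite !mxE; ring.
Qed.

(* The frontier near p as a graph over the orthogonal complement of u; where
   the line has no last point in C, the value is the junk 0. *)
Definition graph_fun x : R :=
  xget 0 [set s | line_top (orth u x) s] * inner u u.

Lemma graph_funE x s : line_top (orth u x) s -> graph_fun x = s * inner u u.
Proof.
move=> xs; congr (_ * _); apply: xget_unique => // s'.
by move/line_top_unique; apply.
Qed.

Lemma graph_fun_near x : inner (x - p) (x - p) < inner u u ->
  [/\ line_top (orth u x) (graph_fun x / inner u u),
      inner u p - inner (x - p) (x - p) <= graph_fun x &
      graph_fun x <= inner u p].
Proof.
move=> xp; have xp' := inner_orth_le (x - p).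
have [||s top /andP[le1 le2]] := @line_top_exists (orth u x).
- exact: inner_orth.
- by rewrite orthB; apply: le_lt_trans xp.
rewrite (graph_funE top) mulfK ?gt_eqF //; split=> //.
by apply: le_trans le1; rewrite orthB lerD2l lerN2.
Qed.

Lemma graph_fun_p : graph_fun p = inner u p.
Proof.
have [|_ le1 le2] := @graph_fun_near p; first by rewrite subrr inner0r.
by apply: le_anti; rewrite le2 /=; move: le1; rewrite subrr inner0r subr0.
Qed.

Lemma graph_fun_frontier x : inner (x - p) (x - p) < inner u u ->
  frontier C x <-> inner u x = graph_fun x.
Proof.
move=> xp; have [top _ _] := graph_fun_near xp.
rewrite (frontierE _ clC); set h := graph_fun x / inner u u in top.
have hE : graph_fun x = h * inner u u by rewrite divfK // gt_eqF.
set s := inner u x / inner u u.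
have sE : inner u x = s * inner u u by rewrite divfK // gt_eqF.
have [Ch hM] := top; have xE : x = orth u x + s *: u by exact: orth_decomp.
have uw : inner u (orth u x) = 0 by exact: inner_orth.
split=> [[Cx nCx]|xh].
  rewrite sE hE; congr (_ * _); apply/eqP; rewrite eq_le hM -?xE //= leNgt.
  apply/negP => sh; apply: nCx.
  pose s0 := inner u p / inner u u.
  have xp' := xp; rewrite xE inner_line // -/s0 in xp'.
  have := inner_ge0 (orth u x - orth u p).
  set d := inner (orth u x - orth u p) _ in xp' * => d0.
  have d1 : d < inner u u.
    by have := mulr_ge0 (sqr_ge0 (s - s0)) (ltW uu); lra.
  have s1 : (s - s0) ^+ 2 < 1.
    by rewrite -(ltr_pM2r uu) mul1r; lra.
  have s2 : s0 - 1 < s by nra.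
  (* Height [s0 - 1] is that of the centre [c], where the line is inside the open ball; a point
     strictly between it and the top is interior. *)
  pose t := (s - (s0 - 1)) / (h - (s0 - 1)).
  have h0 : 0 < h - (s0 - 1) by lra.
  have tE : t * (h - (s0 - 1)) = s - (s0 - 1) by rewrite divfK // gt_eqF.
  have -> : x =
      t *: (orth u x + h *: u) + (1 - t) *: (orth u x + (s0 - 1) *: u).
    have sT : s = t * (h - (s0 - 1)) + (s0 - 1) by rewrite tE subrK.
    rewrite [LHS]xE sT; move: (orth u x) => w.
    by apply/rowP => i; rewrite !mxE; ring.
  apply: convex_interior => //.
  - apply: open_ball_interior; rewrite inner_line_center // -/s0 -/d.
    have -> : 1 + (s0 - 1) - s0 = 0 by ring.
    by rewrite expr0n mul0r addr0.
  - by rewrite divr_ge0 ?ltW // subr_gt0.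
  - by rewrite ltr_pdivrMr // mul1r ltrD2r.
have sh : s = h by apply: (mulIf (lt0r_neq0 uu)); rewrite -sE -hE.
split; first by rewrite xE sh.
move=> /nbhs_innerP[r r0 rC].
(* Conversely, an interior point at the top could be raised by [e], contradicting maximality; [e]
   keeps the raised point within [r]. *)
pose e := r / (1 + inner u u).
have u1 : 0 < 1 + inner u u by rewrite addr_gt0.
have e0 : 0 < e by rewrite divr_gt0.
have eE : e * (1 + inner u u) = r by rewrite divfK // gt_eqF.
clearbody e.
have : C (orth u x + (s + e) *: u).
  apply: rC; rewrite scalerDl addrA -xE addrAC subrr add0r innerZl innerZr.
  rewrite mulrA -expr2 -eE exprMn ltr_pM2l ?exprn_gt0 //.
  have -> : (1 + inner u u) ^+ 2 = 1 + 2 * inner u u + inner u u ^+ 2 by ring.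
  by have := uu; have := sqr_ge0 (inner u u); lra.
by move=> /hM; rewrite sh leNgt ltrDl e0.
Qed.

(* Near p the function lies between its value at p and a paraboloid, so it
   is differentiable at p with zero differential. *)
Lemma graph_fun_diff :
  differentiable graph_fun p /\ 'd graph_fun p = 0 :> ('rV[R]_m -> R).
Proof.
apply: (@quadratic_differentiable _ _ _ _ m%:R).
have : inner (0 - 0 : 'rV[R]_m) (0 - 0) < inner u u by rewrite subrr inner0r.
move/nbhs_open_ball; apply: filterS => h /=; rewrite subr0 => hu.
apply: le_trans (inner_le_mx_norm h).
have [|_ le1 le2] := @graph_fun_near (h + p); first by rewrite addrK.
rewrite graph_fun_p distrC ger0_norm ?subr_ge0 //.
by rewrite lerBlDr -lerBlDl; move: le1; rewrite addrK.
Qed.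

(** As the differential vanishes, the affine approximation is constant and its graph is the
    hyperplane through [p] with normal [u]. *)
Lemma touching_tangent : tangent_to C (hyperplane u p).
Proof.
have [_ Cp nCp _] := Ccp.
exists p, u, graph_fun; have [diff d0] := graph_fun_diff.
split=> //.
- by rewrite (frontierE _ clC).
- split=> // [x t|].
    suff orthE : orth u (x + t *: u) = orth u x by rewrite /graph_fun orthE.
    rewrite /orth innerDr innerZr mulrDl mulfK ?gt_eqF // scalerDl.
    by rewrite opprD addrACA subrr addr0.
  have : inner (p - p) (p - p) < inner u u by rewrite subrr inner0r.
  by move/nbhs_open_ball; apply: filterS => x /= /graph_fun_frontier.
apply/seteqP; split=> x; rewrite /hyperplane /= d0 innerDr innerNr.
  by move=> ->; rewrite subrr.
by move=> /eqP; rewrite subr_eq0 => /eqP.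
Qed.

End TouchingPoint.
End Touching.

(** * Blow-up of the projection at a touching point *)

Section Blowup.
Variables (R : realType) (m : nat).
Implicit Types (x y z w p q u c : 'rV[R]_m) (t s r e : R) (K C : set 'rV[R]_m).

(* The difference quotients of the projection at a touching point converge to
   the projection onto the tangent half-space. *)
Lemma metric_proj_blowup C c p z e : closed C -> convex_set C ->
  touching C c p -> 0 <= inner (p - c) z -> 0 < e ->
  exists t, 0 < t /\
    let d := t^-1 *: (metric_proj C (p + t *: z) - p) - orth (p - c) z in
    inner d d < e ^+ 2.
Proof.
move=> clC cC Ccp uz e0; have [pc Cp _ bC] := Ccp.
have sq1 (h u : 'rV[R]_m) a b : inner u h = 0 ->
    inner (a *: h + b *: u) (a *: h + b *: u) =
    a ^+ 2 * inner h h + b ^+ 2 * inner u u.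
  by move=> uh; rewrite !innerE (innerC h u) uh; ring.
have sq2 (h s u : 'rV[R]_m) b : inner u h = 0 ->
    inner (h - s + b *: u) (h - s + b *: u) =
    inner (s - h) (s - h) - 2 * b * inner u s + b ^+ 2 * inner u u.
  by move=> uh; rewrite !innerE (innerC h u) (innerC s u) uh (innerC s h); ring.
have vec1 (h u s : 'rV[R]_m) a b :
    p + a *: (h + b *: u) - (p + a *: s) = a *: (h - s + b *: u).
  by apply/rowP => i; rewrite !mxE; ring.
have vec2 (h u : 'rV[R]_m) a b d :
    p + a *: (h + b *: u) - (p + a *: h - (a ^+ 2 * d) *: u) =
    (a * (b + a * d)) *: u.
  by apply/rowP => i; rewrite !mxE; ring.
have nZ (v : 'rV[R]_m) a : inner (a *: v) (a *: v) = a ^+ 2 * inner v v.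
  by rewrite innerZl innerZr mulrA.
have supp x := @touching_support _ _ C c p cC Ccp x.
have cE : c = p - (p - c) by rewrite opprB addrC subrK.
have u0 : p - c != 0 by rewrite subr_eq0.
set u := p - c in u0 uz supp bC cE *.
have uu := inner_gt0 u0; set n := inner u u in uu bC.
have uh := inner_orth z u0; have zE := orth_decomp c p z; rewrite -/u in zE.
set h := orth u z in uh zE *; set b := inner u z / inner u u in zE.
have b0 : 0 <= b by rewrite divr_ge0 // ltW.
pose M := inner h h / n; have hM : inner h h = M * n by rewrite divfK // gt_eqF.
have M0 : 0 <= M by rewrite divr_ge0 ?inner_ge0 // ltW.
pose B := (2 * b * M + M ^+ 2) * n.
have B0 : 0 <= B.
  apply: mulr_ge0 (ltW uu).
  by have := mulr_ge0 b0 M0; have := sqr_ge0 M; lra.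
have e2 : 0 < e ^+ 2 by rewrite exprn_gt0.
pose B' := B / e ^+ 2.
have B'0 : 0 <= B' by rewrite divr_ge0 // ltW.
have B'E : B' * e ^+ 2 = B by rewrite divfK // gt_eqF.
have T0 : 0 < 1 + M + B' by lra.
(* The squared error will be at most [t * B]; this [t] makes it less than [e ^+ 2], and keeps [t]
   and [t * M] at most 1. *)
pose t := (1 + M + B')^-1.
have t0 : 0 < t by rewrite invr_gt0.
have tE : t * (1 + M + B') = 1 by rewrite mulVf // gt_eqF.
have tM0 : 0 <= t * M by rewrite mulr_ge0 // ltW.
have tB0 : 0 <= t * B' by rewrite mulr_ge0 // ltW.
have t1 : t <= 1 by lra.
have tB : t * B < e ^+ 2.
  by rewrite -B'E mulrA -[X in _ < X]mul1r ltr_pM2r //; lra.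
exists t; split=> //=; rewrite -/u -/h.
(* A competitor for the projection: the tangential move [t *: h], lowered just enough to remain in
   the touching ball. *)
pose q := p + t *: h - (t ^+ 2 * M) *: u.
have Cq : C q.
  apply: bC; have -> : q - c = t *: h + (1 - t ^+ 2 * M) *: u.
    by rewrite cE /q; apply/rowP => i; rewrite !mxE; ring.
  rewrite sq1 // -/n.
  rewrite hM; have a0 : 0 <= t ^+ 2 * M by rewrite mulr_ge0 ?sqr_ge0.
  have a1 : t ^+ 2 * M <= 1.
    by rewrite expr2 -mulrA mulr_ile1 // ?(ltW t0) //; lra.
  rewrite mulrA; move: (t ^+ 2 * M) a0 a1 => a a0 a1.
  rewrite -mulrDl -[X in _ <= X]mul1r ler_wpM2r ?(ltW uu) //; nra.
have [Cr rmin] := @metric_projP _ _ C (p + t *: z) (ex_intro _ p Cp) clC.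
have := supp _ Cr; have := rmin _ Cq.
set r := metric_proj C _ in Cr *; set s := t^-1 *: (r - p).
have rE : r = p + t *: s.
  by rewrite /s scalerA mulfV ?gt_eqF // scale1r addrC subrK.
clearbody s; rewrite rE.
have -> : p + t *: z - (p + t *: s) = t *: (h - s + b *: u).
  by rewrite [in LHS]zE vec1.
have -> : p + t *: z - q = (t * (b + t * M)) *: u.
  by rewrite [in LHS]zE vec2.
have -> : p + t *: s - p = t *: s by rewrite addrAC subrr add0r.
rewrite 2!nZ innerZr -/n.
rewrite (pmulr_rle0 _ t0) => + us.
rewrite exprMn -[X in _ <= X]mulrA ler_pM2l ?exprn_gt0 //.
(* After expansion the terms b^2 n cancel, the supporting hyperplane gives <u,s> <= 0, and what
   remains is at most [t * B]. *)
rewrite sq2 // -/n.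
have : 0 <= - (b * inner u s) by rewrite -mulrN mulr_ge0 // oppr_ge0.
have : t ^+ 2 * M ^+ 2 * n <= t * M ^+ 2 * n.
  rewrite ler_wpM2r ?(ltW uu) // ler_wpM2r ?sqr_ge0 //.
  by rewrite expr2 -[X in _ <= X]mulr1 ler_wpM2l // ltW.
have : t * B = 2 * t * b * M * n + t * M ^+ 2 * n by rewrite /B; ring.
have -> : (b + t * M) ^+ 2 * n =
    b ^+ 2 * n + 2 * t * b * M * n + t ^+ 2 * M ^+ 2 * n.
  by ring.
lra.
Qed.

(** Isotonicity puts the difference quotients at [p] in [K], and closedness passes this to their
    limit. *)
Lemma isotone_touching_orth K C c p z : convex_cone K -> closed K ->
  closed C -> convex_set C -> touching C c p ->
  isotone K (metric_proj C) -> K z -> K (orth (p - c) z).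
Proof.
move=> [_ _ KZ] clK clC cC Ccp iso Kz; have [_ Cp _ _] := Ccp.
apply: closed_innerP clK _ => e e0.
have [uz|uz] := leP 0 (inner (p - c) z).
  have [t [t0 lt]] := metric_proj_blowup clC cC Ccp uz e0.
  exists (t^-1 *: (metric_proj C (p + t *: z) - p)) => //.
  apply: (KZ); first by rewrite invr_ge0 ltW.
  rewrite -{2}(metric_proj_id Cp); apply: iso.
  by rewrite /cone_le addrAC subrr add0r; apply: (KZ) => //; apply: ltW.
(* For the other sign the blow-up runs along [- z], with [p] now the larger point, and [orth] is
   odd. *)
have uz' : 0 <= inner (p - c) (- z) by rewrite innerNr oppr_ge0 ltW.
have [t [t0 lt]] := metric_proj_blowup clC cC Ccp uz' e0.
exists (t^-1 *: (p - metric_proj C (p + t *: - z))).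
  apply: (KZ); first by rewrite invr_ge0 ltW.
  rewrite -{1}(metric_proj_id Cp); apply: iso.
  rewrite /cone_le opprD addrA subrr add0r scalerN opprK.
  by apply: (KZ) => //; apply: ltW.
move: lt => /=; set r := metric_proj C _.
have -> : orth (p - c) (- z) = - orth (p - c) z.
  by rewrite /orth innerNr mulNr scaleNr opprD.
rewrite opprK -[t^-1 *: (p - r) - _]opprK innerNl innerNr opprK.
by rewrite opprB -scalerN opprB addrC.
Qed.

End Blowup.

(** * Countably many tangent half-spaces determine the set *)

Section Representation.
Variables (R : realType) (m : nat).
Implicit Types (x y z w p q u c : 'rV[R]_m) (t s r e : R) (K C : set 'rV[R]_m).

Definition rat_rV (n : nat) : 'rV[R]_m :=
  map_mx ratr (odflt 0 (unpickle n : option 'rV[rat]_m)).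

Lemma rat_rV_dense x (A : set 'rV[R]_m) : nbhs x A -> exists n, A (rat_rV n).
Proof.
move=> /nbhs_ballP[e /= e0 eA].
have /choice[q qP] : forall i, exists q : rat, `|x 0 i - ratr q| < e.
  move=> i.
  have [|q] := @rat_in_itvoo R (x 0 i - e) (x 0 i + e); first by lra.
  by rewrite in_itv /= => qP; exists q; rewrite ltr_norml; lra.
exists (pickle (\row_i q i)); rewrite /rat_rV pickleK /=; apply: eA.
by split=> // i j; rewrite !mxE ord1; apply: qP.
Qed.

(** The parameter is the last one for which the segment from [x] to [y] is in [C]; at an interior
    point it could be increased. *)
Lemma segment_exit C x y : closed C -> convex_set C -> C x -> ~ C y ->
  exists t, [/\ 0 <= t, t < 1, C (t *: y + (1 - t) *: x) &
    ~ C° (t *: y + (1 - t) *: x)].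
Proof.
move=> clC /convex_setP cC Cx Cy.
pose f t := t *: y + (1 - t) *: x.
have fE t : f t = x + t *: (y - x).
  by apply/rowP => i; rewrite !mxE; ring.
pose S := [set t | 0 <= t <= 1 /\ C (f t)].
have S0 : S 0 by split; [rewrite lexx ler01|rewrite fE scale0r addr0].
have hub : has_ubound S by exists 1 => t [/andP[]].
have cf : continuous f.
  move=> t; rewrite (_ : f = fun s => x + s *: (y - x)); last exact/funext.
  apply: (@cvgD _ _ _ _ _ (cst x) (fun s => s *: (y - x))).
    exact: cvg_cst.
  exact: scalel_continuous.
have clS : closed S.
  have -> : S = [set t | 0 <= t] `&` [set t | t <= 1] `&` (f @^-1` C).
    apply/seteqP; split=> t /=; first by move=> [/andP[]].
    by move=> [[? ?] ?]; split=> //; apply/andP.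
  apply: closedI; first by apply: closedI; [exact: closed_ge|exact: closed_le].
  by apply: preimage_closed => // t _; apply: cf.
have Ss : S (sup S).
  by rewrite [S in S _](closure_id S).1 //; apply: closure_sup => //; exists 0.
have [/andP[s0 s1] Cs] := Ss.
have s1' : sup S < 1.
  rewrite lt_neqAle s1 andbT; apply/eqP => sE; apply: Cy.
  by have := Cs; rewrite /f sE subrr scale0r addr0 scale1r.
exists (sup S); split=> // /nbhs_innerP[r r0 rC].
have n0 : 0 < 1 + inner (y - x) (y - x) by have := inner_ge0 (y - x); lra.
set n := inner (y - x) (y - x) in n0 rC.
pose b := r / (1 + n); have b0 : 0 < b by rewrite divr_gt0.
have bE : b * (1 + n) = r by rewrite divfK // gt_eqF.
have [d [d0 d1 db]] : exists d, [/\ 0 < d, d <= 1 - sup S & d <= b].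
  exists (Num.min (1 - sup S) b); split; last 2 first.
  - by rewrite ge_min lexx.
  - by rewrite ge_min lexx orbT.
  by rewrite lt_min subr_gt0 s1' b0.
have : S (sup S + d).
  split; first by apply/andP; split; lra.
  apply: rC; rewrite -/(f (sup S)) !fE.
  have -> : x + (sup S + d) *: (y - x) - (x + sup S *: (y - x)) = d *: (y - x).
    by apply/rowP => i; rewrite !mxE; ring.
  have n1 : 0 <= n by exact: inner_ge0.
  rewrite innerZl innerZr -/n mulrA -expr2 -bE; clearbody b n.
  have : d ^+ 2 * n <= b ^+ 2 * n.
    by rewrite ler_wpM2r // lerXn2r ?nnegrE // ltW.
  move=> /le_lt_trans; apply; rewrite exprMn ltr_pM2l ?exprn_gt0 //.
  have -> : (1 + n) ^+ 2 = 1 + 2 * n + n ^+ 2 by ring.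
  by have := sqr_ge0 n; lra.
by move=> /(ub_le_sup hub); lra.
Qed.

(** Separation stable under moving the support point: a ball around [x0] puts [x0] deep inside every
    supporting half-space. If [y] were inside too, so would be [w], at a depth incompatible with [p]
    near [w]. *)
Lemma separating_point C y : closed C -> convex_set C -> C° !=set0 -> ~ C y ->
  exists w e, [/\ 0 < e, C w, ~ C° w & forall p u, u != 0 ->
    (forall x, C x -> inner u (x - p) <= 0) ->
    inner (p - w) (p - w) < e ^+ 2 -> 0 < inner u (y - p)].
Proof.
move=> clC cC [x0 Cx0] Cy.
have [t [t0 t1 Cw nCw]] := segment_exit clC cC (interior_subset Cx0) Cy.
have [r r0 rC] := (nbhs_innerP _ _).1 Cx0.
set w := t *: y + _ in Cw nCw.
have t1' : 0 < 1 - t by lra.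
exists w, ((1 - t) * (r / 2)); split=> //; first by rewrite mulr_gt0 ?divr_gt0.
move=> p u u0 supp pw; rewrite ltNge; apply/negP => yp.
have uu := inner_gt0 u0; set n := Num.sqrt (inner u u).
have nn : n ^+ 2 = inner u u by rewrite sqr_sqrtr ?inner_ge0.
have n0 : 0 < n by rewrite sqrtr_gt0.
have x0p : inner u (x0 - p) <= - (r / 2 * n).
  have /supp : C (x0 + (r / 2 / n) *: u).
    apply: rC; rewrite addrAC subrr add0r innerZl innerZr -nn mulrA.
    rewrite -expr2 -exprMn divfK ?gt_eqF // ltr_pXn2r ?nnegrE ?ltW //; lra.
  rewrite addrAC (innerDr u (x0 - p)) innerZr -nn expr2 mulrA divfK ?gt_eqF //.
  by lra.
have wp : inner u (w - p) <= - ((1 - t) * (r / 2) * n).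
  have -> : w - p = t *: (y - p) + (1 - t) *: (x0 - p).
    by apply/rowP => i; rewrite !mxE; ring.
  rewrite innerDr !innerZr -mulrA -mulrN.
  have := ler_wpM2l (ltW t1') x0p; have : t * inner u (y - p) <= 0.
    by rewrite mulr_ge0_le0.
  by lra.
have := cauchy_schwarz u (w - p); rewrite -nn inner_sub_sym => cs.
have : inner u (w - p) ^+ 2 < n ^+ 2 * ((1 - t) * (r / 2)) ^+ 2.
  by apply: le_lt_trans cs _; rewrite ltr_pM2l ?exprn_gt0.
rewrite -exprMn mulrC; set k := (1 - t) * (r / 2) in wp *.
have k0 : 0 < k * n by rewrite !mulr_gt0 ?divr_gt0.
rewrite ltNge; apply/negP/negPn; rewrite -[X in _ <= X]sqrrN.
by rewrite lerXn2r ?nnegrE //; lra.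
Qed.

Lemma touching_representation C : closed C -> convex_set C -> C° !=set0 ->
  exists (I : set nat) (c p : nat -> 'rV[R]_m),
    C = \bigcap_(i in I) halfspace (p i - c i) (p i) /\
    (forall i, I i -> touching C (c i) (p i)).
Proof.
move=> clC cC C0.
have halfE u a x : halfspace u a x = (inner u (x - a) <= 0) :> Prop.
  by rewrite /halfspace /= innerDr innerNr subr_le0.
(* The whole space has no touching points and is the empty intersection. *)
have [CT|CT] := pselect (C = setT).
  by exists set0, (fun=> 0), (fun=> 0); split=> //; rewrite bigcap_set0.
pose I := [set n | C° (rat_rV n)].
have /choice[p pP] : forall n, exists p, I n -> touching C (rat_rV n) p /\
    forall w, ~ C° w -> inner (rat_rV n - p) (rat_rV n - p) <=
                        inner (rat_rV n - w) (rat_rV n - w).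
  move=> n; have [In|nIn] := pselect (I n); last by exists 0.
  by have [p] := nearest_touching clC In CT; exists p.
exists I, rat_rV, p; split=> [|i /pP[]//].
apply/seteqP; split=> [x Cx i /pP[tp _]|y yC].
  by rewrite halfE; apply: touching_support tp _ Cx.
apply: contrapT => nCy.
have [w [e [e0 Cw nCw sep]]] := separating_point clC cC C0 nCy.
have [x0 Cx0] := C0.
(* A squared radius: a centre within e/2 of [w] has its touching point within [e] of [w]. *)
pose r := e ^+ 2 / 4; have r0 : 0 < r by rewrite divr_gt0 ?exprn_gt0.
pose n := inner (x0 - w) (x0 - w).
have n0 : 0 <= n by exact: inner_ge0.
(* Pushes [w] towards [x0] to an interior point still within the radius, so that density provides a
   rational centre there. *)
pose t := r / (1 + n + r).
have d0 : 0 < 1 + n + r by lra.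
have t0 : 0 < t by rewrite divr_gt0.
have t1 : t < 1 by rewrite ltr_pdivrMr //; lra.
have tE : t * (1 + n + r) = r by rewrite divfK // gt_eqF.
have Cz : C° ((1 - t) *: w + (1 - (1 - t)) *: x0).
  by apply: convex_interior => //; lra.
have zr : inner ((1 - t) *: w + (1 - (1 - t)) *: x0 - w)
    ((1 - t) *: w + (1 - (1 - t)) *: x0 - w) < r.
  have -> : (1 - t) *: w + (1 - (1 - t)) *: x0 - w = t *: (x0 - w).
    by apply/rowP => i; rewrite !mxE; ring.
  rewrite innerZl innerZr -/n mulrA -expr2.
  have : t ^+ 2 * n <= t * n.
    by rewrite ler_wpM2r // expr2 -[X in _ <= X]mulr1 ler_wpM2l // ltW.
  have : 0 < t * (1 + r) by rewrite mulr_gt0 //; lra.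
  by lra.
have [k [Ck kr]] : exists k, C° (rat_rV k) /\
    inner (rat_rV k - w) (rat_rV k - w) < r.
  apply: (rat_rV_dense (x := (1 - t) *: w + (1 - (1 - t)) *: x0)
    (A := C° `&` [set y | inner (y - w) (y - w) < r])).
  apply: filterI; last exact: nbhs_open_ball.
  exact: nbhs_interior.
have [tp pmin] := pP k Ck; have [pc _ _ _] := tp.
have := yC k Ck; rewrite halfE; apply/negP; rewrite -ltNge.
apply: sep => [|x Cx|]; first by rewrite subr_eq0.
  exact: touching_support tp _ Cx.
have := pmin w nCw => le1.
(* Parallelogram estimate: |v - v'|^2 <= 2|v|^2 + 2|v'|^2 <= 4|v|^2 < e^2, as [p k] is no farther
   from the centre than [w]. *)
have := inner_ge0 (rat_rV k - p k + (rat_rV k - w)).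
have -> : p k - w = (rat_rV k - w) - (rat_rV k - p k).
  by rewrite opprB [RHS]addrC addrA subrK.
move: (rat_rV k - w) (rat_rV k - p k) kr le1 => v v' kr le1.
rewrite !innerE (innerC v' v); have : r * 4 = e ^+ 2 by rewrite divfK.
by lra.
Qed.

End Representation.

Theorem corollary1 (R : realType) (m : nat) (K C : set 'rV[R]_m)
    (Kcone : convex_cone K) (Kclosed : closed K) (Knonzero : K <> [set 0])
    (Cclosed : closed C) (Cconvex : convex_set C) (Cinterior : C° !=set0) :
  [<-> K_invariant K C;
       isotone K (metric_proj C) /\ isotone (dual_cone K) (metric_proj C);
       exists (I : set nat) (u a : nat -> 'rV[R]_m),
         C = \bigcap_(i in I) halfspace (u i) (a i) /\
         (forall i, I i ->
            [/\ u i != 0,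
                tangent_to C (hyperplane (u i) (a i))
              & K_invariant K (hyperplane (u i) (a i))]);
       exists (I : set nat) (u a : nat -> 'rV[R]_m),
         C = \bigcap_(i in I) halfspace (u i) (a i) /\
         (forall i, I i ->
            [/\ u i != 0,
                tangent_to C (hyperplane (u i) (a i)),
                isotone_projection_set K (hyperplane (u i) (a i))
              & isotone_projection_set (dual_cone K)
                  (hyperplane (u i) (a i))])].
Proof.
have Dcone := dual_cone_convex_cone K.
have Dclosed := @dual_cone_closed _ _ K.
tfae.
- apply: K_invariant_isotone => //.
  by have [x Cx] := Cinterior; exists x; apply: interior_subset.
- move=> [isoK isoD].
  have [I [c [p [CE tp]]]] := touching_representation Cclosed Cconvex Cinterior.
  exists I, (fun i => p i - c i), p; split=> // i /tp tpi.
  have [pc _ _ _] := tpi.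
  have u0 : p i - c i != 0 by rewrite subr_eq0.
  split=> //; first exact: touching_tangent.
  have [capK cupK] := hyperplane_invariant (p i) Kcone Kclosed u0
    (fun z => isotone_touching_orth Kcone Kclosed Cclosed Cconvex tpi isoK).
  have [capD cupD] := hyperplane_invariant (p i) Dcone Dclosed u0
    (fun z => isotone_touching_orth Dcone Dclosed Cclosed Cconvex tpi isoD).
  by [].
- move=> [I [u [a [CE Hi]]]]; exists I, u, a; split=> // i /Hi[u0 tan inv].
  have H0 := @hyperplane_neq0 _ _ (u i) (a i).
  have clH := @hyperplane_closed _ _ (u i) (a i).
  have cH := @hyperplane_convex _ _ (u i) (a i).
  by have [? ?] := K_invariant_isotone Kcone Kclosed H0 clH cH inv; split.
(* Isotone hyperplanes give invariant half-spaces, and invariance passes to the intersection. *)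
- move=> [I [u [a [CE Hi]]]].
  have inv i : I i -> K_invariant K (halfspace (u i) (a i)).
    move=> /Hi[u0 _ [_ _ _ isoK] [_ _ _ isoD]].
    have [? ?] := halfspace_invariant (a i) Kcone Kclosed u0
      (fun z => isotone_hyperplane_orth Kcone u0 isoK).
    by have [? ?] := halfspace_invariant (a i) Dcone Dclosed u0
      (fun z => isotone_hyperplane_orth Dcone u0 isoD).
  rewrite CE; split=> x y Cx Cy i Ii;
    have [i1 i2 i3 i4] := inv i Ii; have := Cx i Ii; have := Cy i Ii => yi xi.
  + exact: i1.
  + exact: i2.
  + exact: i3.
  + exact: i4.
Qed.
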